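(* For every $k\ge2$, the trace algebra $C_k^{t_{\alpha,0}}$ generates a minimal variety of polynomial growth.
   Context: $F$ is a field of characteristic zero; all algebras are associative, unitary, over $F$. An algebra with trace is an algebra $A$ with a linear map $\mathrm{tr}\colon A\to F$ such that $\mathrm{tr}(ab)=\mathrm{tr}(ba)$ for all $a,b\in A$; $F$ is identified with $F\cdot 1_A\subseteq A$. Let $X=\{x_1,x_2,\dots\}$ and let $\mathcal M$ be the set of monomials in the noncommuting variables of $X$. The free algebra with trace is $F\langle X,\mathrm{Tr}\rangle\cong F\langle X\rangle\otimes F[\mathrm{Tr}(M)\mid M\in\mathcal M]$, where the $\mathrm{Tr}(M)$ are central commuting variables subject to $\mathrm{Tr}(MN)=\mathrm{Tr}(NM)$ and $\mathrm{Tr}(\mathrm{Tr}(M)N)=\mathrm{Tr}(M)\mathrm{Tr}(N)$. Its elements are trace polynomials. A trace polynomial is a trace identity of $A$ if it vanishes whenever the variables are replaced by arbitrary elements of $A$ and $\mathrm{Tr}$ by $\mathrm{tr}$; $\mathrm{Id}^{tr}(A)$ is the set of trace identities of $A$. $MT_n$ is the space of multilinear trace polynomials in $x_1,\dots,x_n$, spanned by the elements $\mathrm{Tr}(x_{i_1}\cdots x_{i_a})\cdots\mathrm{Tr}(x_{j_1}\cdots x_{j_b})x_{l_1}\cdots x_{l_c}$ in which each of $x_1,\dots,x_n$ occurs exactly once. The $n$-th trace codimension is $c_n^{tr}(A)=\dim_F MT_n/(MT_n\cap\mathrm{Id}^{tr}(A))$. The variety $\mathrm{var}^{tr}(A)$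 generated by $A$ is the class of algebras with trace satisfying all trace identities of $A$; for $\mathcal V=\mathrm{var}^{tr}(A)$ put $c_n^{tr}(\mathcal V)=c_n^{tr}(A)$. A variety $\mathcal V$ of algebras with trace is minimal of polynomial growth if $c_n^{tr}(\mathcal V)\approx qn^d$ for some $d\ge1$, $q>0$, and for every proper subvariety $\mathcal U\subsetneq\mathcal V$ generated by a unitary finite dimensional algebra one has $c_n^{tr}(\mathcal U)\approx q'n^s$ with $s<d$. Here $\approx$ denotes asymptotic equality as $n\to\infty$. For $k\ge1$, $C_k$ is the algebra of $k\times k$ upper triangular Toeplitz matrices over $F$, i.e. matrices whose $(i,j)$ entry is $a_{j-i+1}$ for $j\ge i$ and $0$ for $j<i$, with $a_1,\dots,a_k\in F$ (so $C_k\cong F[x]/(x^k)$). For $\alpha\in F$, $C_k^{t_{\alpha,0}}$ is $C_k$ with the trace sending such a matrix to $\alpha a_1$.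
   Formalization: The formal theorem assumes α ≠ 0; for α = 0 the trace is zero and C_k is commutative, so every trace codimension equals 1 and is not asymptotic to qn^d with d ≥ 1, and the claim fails. *)

(* Defs.v *)
From HB Require Import structures.
From mathcomp Require Import all_boot all_order all_algebra all_field.
From mathcomp Require Import finmap multinomials.monalg.
From mathcomp Require Import all_classical all_reals topology normedtype.
From mathcomp Require Import sequences landau.

Set Implicit Arguments.
Unset Strict Implicit.
Unset Printing Implicit Defensive.

Import Order.TTheory GRing.Theory Num.Theory.
Import numFieldNormedType.Exports.

Local Open Scope quotient_scope.
Local Open Scope classical_set_scope.
Local Open Scope ring_scope.

(* [algType F] is associative, unitary and has [1 != 0]. *)
Record trace_alg (F : fieldType) := TraceAlg {
  ta_car :> algType F;
  ta_tr : {scalar ta_car};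
  ta_trC : forall a b, ta_tr (a * b) = ta_tr (b * a)
}.

(* The variables are indexed by [nat] from 0, and words in them are
   [seq nat]. Two words are conjugate when they are of the form MN and NM. *)
Definition conjw (u v : seq nat) : bool :=
  [exists i : 'I_(size u).+1, rot i u == v].

Lemma conjwP u v :
  reflect (exists M N, u = M ++ N /\ v = N ++ M) (conjw u v).
Proof.
apply: (iffP existsP) => [[i /eqP <-]|[M [N [-> ->]]]].
  by exists (take i u), (drop i u); rewrite cat_take_drop.
have lt_MN : (size M < (size (M ++ N)).+1)%N by rewrite size_cat ltnS leq_addr.
by exists (Ordinal lt_MN); rewrite /= rot_size_cat.
Qed.

Lemma conjw_refl : reflexive conjw.
Proof. by move=> u; apply/conjwP; exists u, [::]; rewrite cats0. Qed.

Lemma conjw_sym : symmetric conjw.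
Proof.
by move=> u v; apply/conjwP/conjwP => -[M [N [-> ->]]]; exists N, M.
Qed.

Lemma conjw_trans : transitive conjw.
Proof.
move=> v u w /existsP[i /eqP <-] /existsP[j /eqP <-].
rewrite rot_rot_add; set k := rot_add _ _ _.
have lt_k : (k < (size u).+1)%N by rewrite ltnS leq_rot_add.
by apply/existsP; exists (Ordinal lt_k).
Qed.

Canonical conjw_equiv := EquivRel conjw conjw_refl conjw_sym conjw_trans.

(* Words up to conjugacy: the class of M is the index of the central variable
   Tr(M). The empty word is allowed, so Tr(1) is one of the variables. *)
Notation cword := {eq_quot conjw}.

Section ProdMonomial.
Context (M N : monomType).

Let onep : M * N := (mone, mone).
Let mulp (x y : M * N) : M * N := (mmul x.1 y.1, mmul x.2 y.2).

Let mulpA : associative mulp.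
Proof. by move=> x y z; rewrite /mulp !mulmA. Qed.

Let mul1p : left_id onep mulp.
Proof. by case=> x y; rewrite /mulp !mul1m. Qed.

Let mulp1 : right_id onep mulp.
Proof. by case=> x y; rewrite /mulp !mulm1. Qed.

Let unitp x y : mulp x y = onep -> x = onep /\ y = onep.
Proof.
by case: x y => [x1 x2] [y1 y2] [/unitm[-> ->] /unitm[-> ->]].
Qed.

HB.instance Definition _ :=
  Choice_isMonomialDef.Build (M * N)%type mulpA mul1p mulp1 unitp.
End ProdMonomial.

(* A trace monomial Tr(M_1)...Tr(M_r) M: a commutative monomial in the Tr(M_i)
   and a noncommutative monomial. *)
Notation tmonom := ({cmonom cword} * {fmonom nat})%type.

Definition tmon (ss : seq (seq nat)) (w : seq nat) : tmonom :=
  (\big[mmul/mone]_(s <- ss) ucm (\pi_cword s), FMonom w).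

(* The monoid algebra of a product of monoids is the tensor product of their
   monoid algebras. *)
Notation tpoly F := {malg F[tmonom]}.

Definition Tr (F : fieldType) (p : tpoly F) : tpoly F :=
  \sum_(m <- msupp p)
    << p@_m *g (mmul m.1 (ucm (\pi_cword (m.2 : seq nat))), mone) >>.

Section Evaluation.
Context (F : fieldType) (A : trace_alg F) (phi : nat -> A).

Definition ev_word (w : seq nat) : A := \prod_(i <- w) phi i.

Definition ev_cword (c : cword) : F := ta_tr A (ev_word (repr c)).

Definition ev_tmon (m : tmonom) : A :=
  (\prod_(c <- finsupp m.1) ev_cword c ^+ m.1 c) *: ev_word m.2.

Definition tev (p : tpoly F) : A := \sum_(m <- msupp p) p@_m *: ev_tmon m.

Lemma ev_cwordE (w : seq nat) : ev_cword (\pi_cword w) = ta_tr A (ev_word w).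
Proof.
rewrite /ev_cword; case: piP => v /eqmodP/conjwP[M [N [-> ->]]].
by rewrite /ev_word !big_cat /= ta_trC.
Qed.

Lemma ev_cmonE (m : {cmonom cword}) (d : {fset cword}) :
    (finsupp m `<=` d)%fset ->
  \prod_(c <- finsupp m) ev_cword c ^+ m c = \prod_(c <- d) ev_cword c ^+ m c.
Proof.
move=> le_md; apply: (big_fset_incl _ le_md) => c _.
by rewrite -cmE_neq0 negbK => /eqP ->; rewrite expr0.
Qed.

Lemma ev_cmonM (m1 m2 : {cmonom cword}) :
  \prod_(c <- finsupp (mmul m1 m2)) ev_cword c ^+ mmul m1 m2 c =
  (\prod_(c <- finsupp m1) ev_cword c ^+ m1 c) *
  \prod_(c <- finsupp m2) ev_cword c ^+ m2 c.
Proof.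
rewrite (ev_cmonE (fsubsetUl (finsupp m1) (finsupp m2))).
rewrite (ev_cmonE (fsubsetUr (finsupp m1) (finsupp m2))) mdomD -big_split /=.
by apply: eq_bigr => c _; rewrite cmM exprD.
Qed.

Lemma ev_tmonE ss w :
  ev_tmon (tmon ss w) = (\prod_(s <- ss) ta_tr A (ev_word s)) *: ev_word w.
Proof.
rewrite /ev_tmon /=; congr (_ *: _).
elim: ss => [|s ss IHss]; first by rewrite !big_nil mdom1 big_seq_fset0.
by rewrite !big_cons ev_cmonM IHss mdomU big_seq_fset1 cmUU ev_cwordE.
Qed.

Lemma tevEw (p : tpoly F) (d : {fset tmonom}) :
  (msupp p `<=` d)%fset -> tev p = \sum_(m <- d) p@_m *: ev_tmon m.
Proof.
move=> le_pd; apply: (big_fset_incl _ le_pd) => m _ /mcoeff_outdom ->.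
by rewrite scale0r.
Qed.

Lemma tev_is_linear : linear tev.
Proof.
move=> a p q; pose d := (msupp p `|` msupp q `|` msupp (a *: p + q))%fset.
rewrite (tevEw (d := d)) ?fsubsetUr // (@tevEw p d); last first.
  by rewrite /d -fsetUA fsubsetUl.
rewrite (@tevEw q d); last by rewrite /d fsetUAC fsubsetUr.
rewrite scaler_sumr -big_split /=; apply: eq_bigr => m _.
by rewrite mcoeffD mcoeffZ scalerDl !scalerA.
Qed.

HB.instance Definition _ :=
  GRing.isLinear.Build F (tpoly F) A _ tev tev_is_linear.

Lemma tevU c m : tev << c *g m >> = c *: ev_tmon m.
Proof. by rewrite (tevEw msuppU_le) big_seq_fset1 mcoeffUU. Qed.

Lemma tevTr p : tev (Tr p) = (ta_tr A (tev p))%:A.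
Proof.
rewrite /Tr linear_sum [tev p]/tev linear_sum scaler_suml.
apply: eq_bigr => m _.
rewrite [LHS]tevU !linearZ /= /ev_tmon ev_cmonM mdomU big_seq_fset1 cmUU.
by rewrite ev_cwordE fm1 /ev_word big_nil !scalerA expr1 mulrC mulrA.
Qed.

End Evaluation.

Definition trace_id (F : fieldType) (A : trace_alg F) : set (tpoly F) :=
  [set p | forall phi : nat -> A, tev phi p = 0].

(* A class of trace algebras; [set] lives in too small a universe for it. *)
Definition alg_class (F : fieldType) := trace_alg F -> Prop.

Definition var (F : fieldType) (A : trace_alg F) : alg_class F :=
  fun B => trace_id A `<=` trace_id B.

Definition proper_subclass (F : fieldType) (U V : alg_class F) : Prop :=
  (forall B, U B -> V B) /\ exists B, V B /\ ~ U B.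

(* Every letter of [iota 0 n] occurs exactly once; no factor Tr(1) occurs. *)
Definition multilinear (n : nat) (m : tmonom) : Prop :=
  exists ss w,
    [/\ [::] \notin ss, perm_eq (flatten ss ++ w) (iota 0 n) & m = tmon ss w].

Definition MT (F : fieldType) (n : nat) : set (tpoly F) :=
  [set p | forall m, m \in msupp p -> multilinear n m].

(* For subspaces V and W: the classes of the [e i] form a basis of
   V / (V `&` W). *)
Definition quot_basis (F : fieldType) (L : lmodType F) (V W : set L)
    (m : nat) (e : 'I_m -> L) : Prop :=
  (forall i, V (e i)) /\
  forall v, V v -> exists! c : 'rV[F]_m, W (v - \sum_(i < m) c 0 i *: e i).

(* The default 0 is returned only when V / (V `&` W) has no finite basis, which
   does not occur below since the spaces [MT] are finite dimensional. *)
Definition quot_dim (F : fieldType) (L : lmodType F) (V W : set L) : nat :=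
  xget 0%N [set m | exists e : 'I_m -> L, quot_basis V W e].

Definition trace_codim (F : fieldType) (A : trace_alg F) (n : nat) : nat :=
  quot_dim (@MT F n) (trace_id A).

Definition asymp_poly (R : realType) (c : nat -> nat) (q : R) (d : nat) : Prop :=
  (fun n => (c n)%:R : R^o) ~_\oo (fun n => q * n%:R ^+ d : R^o).

(* A stands for the variety [var A]. A finite dimensional unitary algebra is a
   [falgType]; d = 0 is excluded for [var A] but s = 0 is allowed. *)
Definition minimal_poly_growth (R : realType) (F : fieldType)
    (A : trace_alg F) : Prop :=
  exists (d : nat) (q : R),
    [/\ (1 <= d)%N, 0 < q, asymp_poly (trace_codim A) q d &
      forall (B : falgType F) (tr : {scalar B})
          (trC : forall a b, tr (a * b) = tr (b * a)),
        let U := TraceAlg trC in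
        proper_subclass (var U) (var A) ->
        exists (s : nat) (q' : R),
          [/\ (s < d)%N, 0 < q' & asymp_poly (trace_codim U) q' s]].

(* The k x k matrices are taken in ['M[F]_k.-1.+1], which is convertible to
   ['M[F]_k] for a successor k, so that they form a nontrivial algebra. *)
Section Toeplitz.
Context (F : fieldType) (k : nat).

Definition toeplitz_pred : {pred 'M[F]_k.-1.+1} := fun M =>
  [forall i, forall j,
     M i j == if (i <= j)%N then M ord0 (inord (j - i)) else 0].

Lemma toeplitzP (M : 'M[F]_k.-1.+1) :
  reflect (exists a : nat -> F,
             forall i j, M i j = if (i <= j)%N then a (j - i)%N else 0)
          (M \in toeplitz_pred).
Proof.
apply: (iffP forallP) => [TM|[a Ma] i].
  exists (fun t => M ord0 (inord t)) => i j.
  by have /forallP/(_ j)/eqP := TM i.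
apply/forallP => j; rewrite !Ma leq0n subn0 inordK //.
by rewrite (leq_ltn_trans (leq_subr _ _)).
Qed.

Lemma toeplitz_subalg : subalg_closed toeplitz_pred.
Proof.
split.
- apply/toeplitzP; exists (fun t => (t == 0%N)%:R) => i j.
  rewrite mxE -val_eqE eqn_leq subn_eq0 /=.
  by case: (i <= j)%N; case: (j <= i)%N.
- move=> c u v /toeplitzP[a ua] /toeplitzP[b vb].
  apply/toeplitzP; exists (fun t => c * a t + b t) => i j.
  by rewrite !mxE ua vb; case: ifP => // _; rewrite mulr0 addr0.
- move=> u v /toeplitzP[a ua] /toeplitzP[b vb].
  apply/toeplitzP; exists (fun t => \sum_(l < t.+1) a l * b (t - l)%N) => i j.
  rewrite mxE.
  under eq_bigr => l _ do rewrite ua vb.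
  rewrite -(big_mkord xpredT (fun l => (if (i <= l)%N then a (l - i)%N else 0) *
      (if (l <= j)%N then b (j - l)%N else 0))).
  have [le_ij|lt_ji] := leqP i j; last first.
    rewrite big1_seq // => l _.
    case: (leqP i l) => [le_il|]; last by rewrite mul0r.
    by rewrite leqNgt (leq_trans lt_ji) // mulr0.
  rewrite (big_cat_nat (n := i)) //=; last exact/ltnW.
  rewrite big1_seq ?add0r; last first.
    move=> l /andP[_]; rewrite mem_index_iota => /andP[_ lt_li].
    by rewrite leqNgt lt_li mul0r.
  rewrite (big_cat_nat (n := j.+1)) //=; last exact: leqW.
  rewrite [X in _ + X]big1_seq ?addr0; last first.
    move=> l /andP[_]; rewrite mem_index_iota => /andP[lt_jl _].
    by rewrite [(l <= j)%N]leqNgt lt_jl mulr0.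
  rewrite -{1}[val i]add0n big_addn subSn // big_mkord.
  apply: eq_bigr => l _; rewrite leq_addl addnK.
  have le_lij : (l + i <= j)%N by rewrite addnC -leq_subRL // -ltnS.
  by rewrite le_lij addnC subnDA.
Qed.

HB.instance Definition _ :=
  GRing.isSubalgClosed.Build F 'M[F]_k.-1.+1 toeplitz_pred toeplitz_subalg.

Record Calg := CAlg { Calg_val :> 'M[F]_k.-1.+1; _ : Calg_val \in toeplitz_pred }.

HB.instance Definition _ := [isSub for Calg_val].
HB.instance Definition _ := [Choice of Calg by <:].
HB.instance Definition _ := [SubChoice_isSubAlgebra of Calg by <:].

(* [M ord0 ord0] is a_1, the common value of the diagonal entries. *)
Definition Ctr (alpha : F) (M : Calg) : F := alpha * val M ord0 ord0.

Lemma Ctr_is_scalar alpha : scalar (Ctr alpha).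
Proof. by move=> c u v; rewrite /Ctr linearP !mxE mulrDr mulrCA. Qed.

HB.instance Definition _ alpha :=
  GRing.isLinear.Build F Calg F _ (Ctr alpha) (Ctr_is_scalar alpha).

Lemma Ctr_trC alpha (u v : Calg) : Ctr alpha (u * v) = Ctr alpha (v * u).
Proof.
suff E (x y : Calg) : val (x * y) ord0 ord0 =
    val x ord0 ord0 * val y ord0 ord0 by rewrite /Ctr !E [X in _ * X]mulrC.
rewrite rmorphM mxE big_ord_recl big1 ?addr0 // => i _.
case: y => y /= /toeplitzP[a ya]; rewrite ya; exact: mulr0.
Qed.

(* The trace algebra C_k^{t_{alpha,0}}. *)
Definition Ctrace (alpha : F) : trace_alg F :=
  @TraceAlg F Calg (Ctr alpha) (Ctr_trC alpha).

End Toeplitz.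

(* Main.v *)
From HB Require Import structures.
Require Import Defs.
From mathcomp Require Import all_boot all_order all_algebra all_field.
From mathcomp Require Import finmap multinomials.monalg.
From mathcomp Require Import all_classical all_reals topology normedtype.
From mathcomp Require Import sequences landau.

Set Implicit Arguments.
Unset Strict Implicit.
Unset Printing Implicit Defensive.

Import Order.TTheory GRing.Theory Num.Theory.
Import numFieldNormedType.Exports.

Local Open Scope ring_scope.

(** On C_k, and hence on every trace algebra B of its variety, three identities
hold: xy = yx, Tr(1) = alpha and alpha Tr(xy) = Tr(x) Tr(y). So eps = tr / alpha
is a character of the commutative algebra B, and B = F + I with I = ker tr. A
fourth identity, (x - Tr(x) / alpha)^k = 0, bounds the nil index of I by k. Let
s + 1 be the exact nil index of I, so that s < k; for C_k itself s = k - 1. The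
whole growth of B is governed by s.

Codimensions ([trace_codim_binomial_sum]). Modulo the first three identities a
multilinear trace monomial in x_1, ..., x_n is a scalar times the product of the
eps(x_i), i not in S, and of the x_i, i in S, for a subset S of the indices. In
characteristic zero polarization gives I^(s+1) = 0, so all products of s + 1
factors x_i - eps(x_i) vanish and the monomials of the sets S with more than s
elements are combinations of the others ([mixprod_reduce]). The monomials with
#|S| <= s are independent: if z in I has z^s <> 0, substitute z for x_i when i
is in T and 1 otherwise, and only the S containing T survive
([subset_tpoly_free]). Hence the codimension is the sum of the binomial
coefficients C(n, j), j <= s, which is asymptotic to n^s / s!.

Minimality. For C_k this gives growth n^(k-1) / (k-1)!. Suppose that B is in the
variety with s = k - 1, and choose z in I with z^(k-1) <> 0 = z^k. Then F[z] is
a trace subalgebra of B isomorphic to C_k, so B satisfies no more identities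
than C_k ([var_nil_index]) and its variety is not proper. A proper subvariety
therefore has s < k - 1. The isomorphism is never built: F[X] with trace
P |-> alpha P(0) maps onto both F[z] and C_k, with the same kernel (X^k). *)

(** * Nil ideals and polarization *)

Lemma pchar0_natr_eq0 (F : fieldType) n :
  [pchar F] =i pred0 -> (n%:R == 0 :> F) = (n == 0%N).
Proof. by move=> F0; apply: (pcharf0P F).1 n. Qed.

(** A Vandermonde argument without determinants: p(2t) - 2^n p(t) loses the
coefficient of degree n and multiplies the others by 2^i - 2^n, which is nonzero
in characteristic zero. *)
Lemma vector_poly_eq0 (F : fieldType) (V : lmodType F) n (v : nat -> V) :
    [pchar F] =i pred0 ->
    (forall t : F, \sum_(i < n) t ^+ i *: v i = 0) ->
  forall i, (i < n)%N -> v i = 0.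
Proof.
move=> F0; elim: n v => [//|n IHn] v v0.
have lo i : (i < n)%N -> v i = 0.
  move=> lt_in; pose c : F := (2 ^ i)%:R - (2 ^ n)%:R.
  have c_neq0 : c != 0.
    rewrite /c -opprB oppr_eq0 -natrB; last by rewrite leq_exp2l // ltnW.
    by rewrite pchar0_natr_eq0 // -lt0n subn_gt0 ltn_exp2l.
  suff: c *: v i = 0.
    by move/eqP; rewrite scaler_eq0 (negPf c_neq0) => /eqP.
  (* These are the coefficients of p(2t) - 2^n p(t) below degree n. *)
  apply: (IHn (fun i => ((2 ^ i)%:R - (2 ^ n)%:R) *: v i)) lt_in => t.
  have := v0 (2 * t); have := congr1 (fun x => 2 ^+ n *: x) (v0 t).
  rewrite scaler0 => e1 e2; have := congr2 +%R e2 (congr1 -%R e1).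
  rewrite oppr0 addr0 !big_ord_recr /= scalerDr opprD addrACA.
  rewrite !scalerA exprMn subrr addr0 scaler_sumr -sumrB => {2}<-.
  apply: eq_bigr => j _; rewrite !scalerA -scalerBl mulrBr !natrX exprMn.
  by congr ((_ - _) *: _); rewrite mulrC.
move=> i; rewrite ltnS leq_eqVlt => /predU1P[->|/lo //].
have := v0 1; rewrite big_ord_recr /= expr1n scale1r big1 ?add0r // => j _.
by rewrite lo ?scaler0.
Qed.

(** One linearization step at a time: in (x + t y)^r P = 0, valid for all
scalars t, the coefficient of t is r x^(r-1) y P. The power of x drops by one as
each factor y is moved into the product. *)
Lemma nil_polarization (F : fieldType) (C : comAlgType F) (f : {scalar C}) n :
    [pchar F] =i pred0 -> (forall x, f x = 0 -> x ^+ n = 0) ->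
  forall x ys, f x = 0 -> (forall y, y \in ys -> f y = 0) ->
  (size ys <= n)%N -> x ^+ (n - size ys) * \prod_(y <- ys) y = 0.
Proof.
move=> F0 f_nil x ys; elim: ys x => [|y ys IHys] x fx fys le_n /=.
  by rewrite subn0 big_nil mulr1 f_nil.
set r := (n - size ys)%N; set P := \prod_(z <- ys) z.
have r_gt0 : (0 < r)%N by rewrite subn_gt0.
have fys' z : z \in ys -> f z = 0 by move=> zys; rewrite fys // inE zys orbT.
have fy : f y = 0 by rewrite fys // mem_head.
pose v i := x ^+ (r - i) * y ^+ i *+ 'C(r, i) * P.
have coef0 (t : F) : \sum_(i < r.+1) t ^+ i *: v i = 0.
  have fxy : f (x + t *: y) = 0 by rewrite linearD linearZ /= fx fy mulr0 addr0.
  rewrite -[RHS](IHys _ fxy fys' (ltnW le_n)) -/r -/P.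
  rewrite exprDn mulr_suml; apply: eq_bigr => i _.
  by rewrite exprZn -scalerAr scalerMnr -scalerAl.
have := vector_poly_eq0 F0 coef0 (i := 1) r_gt0.
rewrite /v bin1 expr1 subn1 mulrnAl -scaler_nat => /eqP.
rewrite scaler_eq0 pchar0_natr_eq0 // eqn0Ngt r_gt0 /= => /eqP <-.
by rewrite big_cons mulrA subnS.
Qed.

Lemma prod_nil_ker_eq0 (F : fieldType) (C : comAlgType F) (f : {scalar C}) n :
    [pchar F] =i pred0 -> (forall x, f x = 0 -> x ^+ n = 0) ->
  forall ys, (forall y, y \in ys -> f y = 0) -> (n <= size ys)%N ->
  \prod_(y <- ys) y = 0.
Proof.
move=> F0 f_nil ys fys le_n; rewrite -(cat_take_drop n ys) big_cat /=.
have /= := nil_polarization F0 f_nil (linear0 f) (ys := take n ys).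
rewrite size_takel // subnn mul1r => -> //; first by rewrite mul0r.
by move=> y /mem_take/fys.
Qed.

(** * Dimension of a quotient space *)

Section QuotientDimension.
Context (F : fieldType) (L : lmodType F) (V W : set L).
Hypothesis W0 : W 0.
Hypothesis W_lin : forall (a : F) u v, W u -> W v -> W (a *: u + v).

(** The two change-of-basis matrices multiply to the identity because the
coordinates modulo W are unique. *)
Lemma quot_basis_le m m' (e : 'I_m -> L) (e' : 'I_m' -> L) :
  quot_basis V W e -> quot_basis V W e' -> (m <= m')%N.
Proof.
move=> [Ve De] [Ve' De'].
have W_sum n (c : 'I_n -> F) (w : 'I_n -> L) :
    (forall i, W (w i)) -> W (\sum_i c i *: w i).
  by move=> Ww; apply: (big_ind W) => // [x y Wx|i _];
    [rewrite -[x]scale1r; apply: W_lin | rewrite -[_ *: _]addr0; apply: W_lin].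
have /choice[A A_e] i : exists c : 'rV[F]_m', W (e i - \sum_j c 0 j *: e' j).
  by have [c [Wc _]] := De' _ (Ve i); exists c.
have /choice[B B_e] j : exists c : 'rV[F]_m, W (e' j - \sum_i c 0 i *: e i).
  by have [c [Wc _]] := De _ (Ve' j); exists c.
pose MA := \matrix_(i, j) A i 0 j; pose MB := \matrix_(j, i) B j 0 i.
apply: (mulmx1_min (A := MA) (B := MB)); apply/row_matrixP => i.
have [c [_ c_uniq]] := De _ (Ve i).
rewrite -(c_uniq (row i (MA *m MB))) ?(c_uniq (row i 1%:M)) //.
  rewrite (bigD1 i) //= big1 ?addr0 => [|j /negPf j_neq_i].
    by rewrite !mxE eqxx scale1r subrr.
  by rewrite !mxE eq_sym j_neq_i scale0r.
have := W_lin 1 (A_e i) (W_sum _ (fun j => A i 0 j) _ B_e).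
congr W; rewrite scale1r -addrA; congr (_ + _).
under [X in _ + X]eq_bigr do rewrite scalerBr.
rewrite sumrB addrA addNr add0r; congr (- _).
under eq_bigr do rewrite scaler_sumr.
rewrite exchange_big; apply: eq_bigr => l _ /=.
rewrite !mxE scaler_suml; apply: eq_bigr => j _.
by rewrite !mxE scalerA.
Qed.

Lemma quot_dim_eq m (e : 'I_m -> L) : quot_basis V W e -> quot_dim V W = m.
Proof.
move=> De; apply: xget_unique; first by exists e.
move=> m' [e' De'].
by apply/eqP; rewrite eqn_leq (quot_basis_le De' De) (quot_basis_le De De').
Qed.
End QuotientDimension.

(** * Squarefree products in commuting variables *)

Section SubsetMonomials.
Context (F : fieldType) (C : comAlgType F) (I : finType).
Implicit Types (e : I -> F) (a : I -> C) (S T : {set I}).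

(** The value of a multilinear trace monomial in a commutative algebra with
multiplicative trace: the variables outside S stand under a trace and contribute
scalars, those in S contribute ring elements. *)
Definition mixprod e a S : C := (\prod_(i in ~: S) e i) *: \prod_(i in S) a i.

Lemma mixprodE e a S :
  mixprod e a S = \prod_i (if i \in S then a i else (e i)%:A).
Proof.
rewrite (bigID [in S]) /= [X in X * _](eq_bigr a); last by move=> i ->.
rewrite [X in _ * X](eq_bigr (fun i => (e i)%:A)); last by move=> i /negPf ->.
rewrite -(rmorph_prod (in_alg C)) /= -scalerAr mulr1 /mixprod.
by congr (_ *: _); apply: eq_bigl => i; rewrite inE.
Qed.

Lemma eq_mixprod e a e' a' S :
  {in ~: S, e =1 e'} -> {in S, a =1 a'} -> mixprod e a S = mixprod e' a' S.
Proof. by move=> ee' aa'; congr (_ *: _); apply: eq_bigr. Qed.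

(** Used with c = 1 to write x_i = (x_i - e_i) + e_i and with c = -1 to go
back. *)
Lemma mixprod_shift e a c S :
  mixprod e (fun i => a i + c *: (e i)%:A) S =
  \sum_(T : {set I} | T \subset S) c ^+ #|S :\: T| *: mixprod e a T.
Proof.
pose a' i := if i \in S then a i else 0.
pose e' i := if i \in S then c * e i else e i.
rewrite mixprodE (eq_bigr (fun i => a' i + (e' i)%:A)); last first.
  by move=> i _; rewrite /a' /e'; case: (i \in S); rewrite ?add0r // scalerA.
rewrite bigA_distr /= [RHS]big_mkcond; apply: eq_bigr => T _.
rewrite -mixprodE; case: ifP => [sTS|/negbT/subsetPn[i iT iS]]; last first.
  by rewrite mixprodE (bigD1 i) //= iT /a' (negPf iS) mul0r.
rewrite /mixprod scalerA; congr (_ *: _); last first.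
  by apply: eq_bigr => i /(fintype.subsetP sTS) iS; rewrite /a' iS.
rewrite (eq_bigr (fun i => (if i \in S then c else 1) * e i)); last first.
  by move=> i _; rewrite /e'; case: (i \in S); rewrite // mul1r.
rewrite big_split /=; congr (_ * _).
rewrite -big_mkcondr /= -prodr_const; apply: eq_bigl => i.
by rewrite !inE.
Qed.

(** The coefficient of T when the product over S is expanded in the factors
a_i - e_i, the terms with more than m such factors are dropped, and the rest is
expanded back; V is the intermediate set of factors a_i - e_i. *)
Definition mixprod_coef m S T : F :=
  \sum_(V : {set I} | [&& T \subset V, V \subset S & (#|V| <= m)%N])
    (-1) ^+ #|V :\: T|.

Lemma mixprod_reduce e a m S :
    (forall V : {set I}, (m < #|V|)%N -> \prod_(i in V) (a i - (e i)%:A) = 0) ->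
  mixprod e a S =
  \sum_(T : {set I} | (#|T| <= m)%N) mixprod_coef m S T *: mixprod e a T.
Proof.
move=> prod0; pose b i := a i - (e i)%:A.
have -> : mixprod e a S = mixprod e (fun i => b i + 1 *: (e i)%:A) S.
  by apply: eq_mixprod => // i _; rewrite scale1r subrK.
rewrite mixprod_shift (bigID (fun V : {set I} => (#|V| <= m)%N)) /=.
rewrite [X in _ + X]big1 ?addr0 => [|V /andP[_]]; last first.
  by rewrite -ltnNge /mixprod => /prod0->; rewrite !scaler0.
have mixprod_b V : mixprod e b V =
    \sum_(T : {set I} | T \subset V) (-1) ^+ #|V :\: T| *: mixprod e a T.
  by rewrite -mixprod_shift; apply: eq_mixprod => // i _; rewrite scaleN1r.
under eq_bigr do rewrite expr1n scale1r mixprod_b.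
rewrite (exchange_big_dep (fun T : {set I} => (#|T| <= m)%N)) /=; last first.
  by move=> V T /andP[_ leVm] /subset_leq_card/leq_trans; apply.
apply: eq_bigr => T leTm; rewrite /mixprod_coef scaler_suml.
by apply: eq_bigl => V; rewrite andbC.
Qed.

(** The substitution that isolates T: a variable of T left under a trace gives
0, and the variables outside T give 1 wherever they stand. *)
Lemma mixprod_indicator z S T :
  mixprod (fun i => (i \notin T)%:R) (fun i => if i \in T then z else 1) S =
  if T \subset S then z ^+ #|T| else 0.
Proof.
rewrite /mixprod; case: ifP => [sTS|/negbT/subsetPn[i iT iS]]; last first.
  by rewrite (bigD1 i) ?inE //= iT mul0r scale0r.
rewrite big1 ?scale1r => [|i]; last first.
  by rewrite inE => /(contra (fintype.subsetP sTS i)) ->.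
rewrite -big_mkcondr /= -prodr_const; apply: eq_bigl => i.
by rewrite andb_idl // => /(fintype.subsetP sTS).
Qed.

End SubsetMonomials.

(** * Codimensions of commutative algebras with multiplicative trace *)

Section Codimension.
Context (F : fieldType) (C : comAlgType F) (tr : {scalar C}).
Context (trC : forall a b, tr (a * b) = tr (b * a)) (alpha : F).
Hypotheses (F0 : [pchar F] =i pred0) (alpha_neq0 : alpha != 0).
Hypotheses (tr1 : tr 1 = alpha).
Hypothesis trM : forall x y, alpha * tr (x * y) = tr x * tr y.

Let U : trace_alg F := TraceAlg trC.
Let eps x := tr x / alpha.

Lemma tr_prod (J : Type) (s : seq J) (phi : J -> C) :
  tr (\prod_(i <- s) phi i) = alpha * \prod_(i <- s) eps (phi i).
Proof.
elim: s => [|i s IHs]; first by rewrite !big_nil mulr1.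
rewrite !big_cons; apply: (mulfI alpha_neq0).
rewrite trM IHs -[tr (phi i)](divfK alpha_neq0) -/(eps _).
by rewrite [eps _ * alpha]mulrC -mulrA [eps _ * (alpha * _)]mulrCA.
Qed.

(** Each factor Tr(x_i ... x_j) is alpha times a product of eps's because eps is
multiplicative, so only the set of the variables outside all traces matters. *)
Lemma ev_multilinear n (mon : tmonom) : multilinear n mon ->
  exists (b : F) (S : {set 'I_n}), forall phi : nat -> C,
    ev_tmon (A := U) phi mon =
    b *: mixprod (fun i : 'I_n => eps (phi i)) (fun i : 'I_n => phi i) S.
Proof.
case=> ss [w [_ perm_ssw ->]].
exists (alpha ^+ size ss), [set i : 'I_n | val i \in w] => phi.
have uniq_ssw : uniq (flatten ss ++ w).
  by rewrite (perm_uniq perm_ssw) iota_uniq.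
have /and3P[uniq_ss no_common uniq_w] :
    [&& uniq (flatten ss), ~~ has [in flatten ss] w & uniq w].
  by rewrite -cat_uniq.
have big_ord_mem (R : comPzRingType) (s : seq nat) (f : nat -> R) :
    uniq s -> {subset s <= iota 0 n} ->
    \prod_(i <- s) f i = \prod_(i < n | val i \in s) f i.
  move=> uniq_s sub_s; rewrite -(big_mkord (mem s)) -[RHS]big_filter.
  apply: perm_big; apply: uniq_perm; rewrite ?filter_uniq ?iota_uniq // => i.
  by rewrite mem_filter /index_iota subn0 andb_idr //; apply: sub_s.
have mem_ssw i : (i \in flatten ss ++ w) = (i \in iota 0 n).
  exact: perm_mem.
rewrite ev_tmonE /= /ev_word.
rewrite (eq_bigr (fun s => alpha * \prod_(i <- s) eps (phi i))); last first.
  by move=> s _; rewrite tr_prod.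
rewrite big_split /= big_const_seq count_predT iter_mulr_1 -scalerA.
congr (_ *: (_ *: _)).
  rewrite -big_flatten /= big_ord_mem //; last first.
    by move=> i i_ss; rewrite -mem_ssw mem_cat i_ss.
  apply: eq_bigl => i; rewrite !inE.
  have := mem_ssw i; rewrite mem_iota add0n ltn_ord mem_cat /=.
  move/hasPn/(_ (val i)): no_common.
  by case: (val i \in w) => [/(_ isT)/negPf ->|_]; rewrite ?orbF.
rewrite big_ord_mem //; last first.
  by move=> i i_w; rewrite -mem_ssw mem_cat i_w orbT.
by apply: eq_bigl => i; rewrite inE.
Qed.

(** The factor alpha ^- #|~: S| turns every Tr(x_i) into eps(x_i). *)
Definition subset_tpoly n (S : {set 'I_n}) : tpoly F :=
  << alpha ^- #|~: S| *g
     tmon [seq [:: val i] | i <- enum (~: S)] (map val (enum S)) >>.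

Lemma tev_subset_tpoly n (S : {set 'I_n}) (phi : nat -> C) :
  tev (A := U) phi (subset_tpoly S) =
  mixprod (fun i : 'I_n => eps (phi i)) (fun i : 'I_n => phi i) S.
Proof.
rewrite tevU ev_tmonE /ev_word !big_map !big_enum /= scalerA; congr (_ *: _).
under eq_bigr do rewrite big_seq1.
rewrite [X in _ * X](eq_bigr (fun i : 'I_n => alpha * eps (phi i))); last first.
  by move=> i _; rewrite /eps mulrC divfK.
rewrite big_split prodr_const /=.
by rewrite mulKf // expf_neq0.
Qed.

Lemma MT_subset_tpoly n (S : {set 'I_n}) : MT n (subset_tpoly S).
Proof.
move=> mon /(fsubsetP msuppU_le); rewrite inE => /eqP ->.
exists [seq [:: val i] | i <- enum (~: S)], (map val (enum S)); split=> //.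
  by apply/mapP => -[].
have -> : flatten [seq [:: val i] | i <- enum (~: S)] = map val (enum (~: S)).
  by elim: (enum _) => //= i s ->.
rewrite -map_cat -val_enum_ord perm_map //.
apply: uniq_perm; rewrite ?enum_uniq // ?cat_uniq ?enum_uniq /= ?andbT.
  by apply/hasPn => i; rewrite !mem_enum inE negbK.
by move=> i; rewrite mem_cat !mem_enum !inE orNb.
Qed.

Context (m : nat) (z : C).
Hypotheses (trz : tr z = 0) (zm : z ^+ m != 0).
Hypothesis nil_ker : forall x, tr x = 0 -> x ^+ m.+1 = 0.

Let D n := [set S : {set 'I_n} | (#|S| <= m)%N].

Lemma MT_spanned n v : MT n v ->
  exists c : {set 'I_n} -> F, forall phi,
    tev (A := U) phi v =
    \sum_(T in D n) c T *: tev (A := U) phi (subset_tpoly T).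
Proof.
move=> MTv.
have /choice[g gP] mon : exists c : {set 'I_n} -> F, mon \in msupp v ->
    forall phi, ev_tmon (A := U) phi mon =
      \sum_(T in D n) c T *: tev (A := U) phi (subset_tpoly T).
  have [mon_v|mon_v] := boolP (mon \in msupp v); last by exists (fun=> 0).
  have [b [S ev_mon]] := ev_multilinear (MTv _ mon_v).
  exists (fun T => b * mixprod_coef F m S T) => _ phi.
  rewrite ev_mon (@mixprod_reduce _ _ _ _ _ m) => [|V lt_mV]; last first.
    rewrite -big_enum /= -(big_map (fun i : 'I_n => phi i - (eps (phi i))%:A)
      xpredT id).
    apply: (prod_nil_ker_eq0 F0 nil_ker); last by rewrite size_map -cardE.
    move=> _ /mapP[i _ ->].
    by rewrite linearB linearZ /= tr1 divfK ?subrr.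
  rewrite scaler_sumr; apply: eq_big => [T|T _]; first by rewrite inE.
  by rewrite tev_subset_tpoly scalerA.
exists (fun T => \sum_(mon <- msupp v) v@_mon * g mon T) => phi.
rewrite /tev; under [RHS]eq_bigr do rewrite scaler_suml.
rewrite exchange_big /= big_seq [RHS]big_seq; apply: eq_bigr => mon mon_v.
by rewrite gP // scaler_sumr; apply: eq_bigr => T _; rewrite scalerA.
Qed.

(** Descending induction on #|T|: evaluated at z on T and at 1 elsewhere, the
relation involves only the supersets of T, and all coefficients but that of T
are already known to vanish, leaving the multiple d_T z^#|T| of a nonzero
element. *)
Lemma subset_tpoly_free n (d : 'I_#|D n| -> F) :
    (forall phi,
       \sum_i d i *: tev (A := U) phi (subset_tpoly (enum_val i)) = 0) ->
  forall i, d i = 0.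
Proof.
move=> d0 i; have [N] := ubnP (n - #|enum_val i|)%N.
elim: N i => // N IHN i le_N; set T := enum_val i in le_N *.
pose phi j := if [exists l : 'I_n, (l \in T) && (val l == j)] then z else 1.
have phiE (j : 'I_n) : phi j = if j \in T then z else 1.
  rewrite /phi; congr (if _ then _ else _); apply/existsP/idP => [[l]|jT].
    by case/andP=> lT /eqP/val_inj <-.
  by exists j; rewrite jT eqxx.
have tevE S : tev (A := U) phi (subset_tpoly S) =
    if T \subset S then z ^+ #|T| else 0.
  rewrite tev_subset_tpoly -mixprod_indicator.
  apply: eq_mixprod => j _; rewrite phiE //.
  by case: (j \in T); rewrite /eps ?trz ?mul0r // tr1 divff.
have := d0 phi; rewrite (bigD1 i) //= big1 ?addr0 => [|j j_neq_i]; last first.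
  rewrite tevE; case: ifP => [sTj|]; last by rewrite scaler0.
  rewrite IHN ?scale0r //.
  have lt_T : (#|T| < #|enum_val j|)%N.
    rewrite proper_card // finset.properEneq sTj andbT.
    by apply: contraNneq j_neq_i => /enum_val_inj ->.
  rewrite -ltnS (leq_trans _ le_N) // ltnS ltn_sub2l //.
  by rewrite (leq_trans lt_T) // -[X in (_ <= X)%N]card_ord max_card.
rewrite tevE subxx => /eqP; rewrite scaler_eq0 => /orP[/eqP //|].
have leTm : (#|T| <= m)%N by have := enum_valP i; rewrite inE.
move=> /eqP zT; move: zm; rewrite -(subnK leTm) exprD zT mulr0 eqxx.
by [].
Qed.

Lemma subset_tpoly_quot_basis n :
  quot_basis (MT n) (trace_id U)
    (fun i : 'I_#|D n| => subset_tpoly (enum_val i)).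
Proof.
split=> [i|v MTv]; first exact: MT_subset_tpoly.
have tev_sub phi (w : tpoly F) (c : 'I_#|D n| -> F) :
    tev (A := U) phi (w - \sum_i c i *: subset_tpoly (enum_val i)) =
    tev (A := U) phi w -
      \sum_i c i *: tev (A := U) phi (subset_tpoly (enum_val i)).
  rewrite linearB (linear_sum (tev (A := U) phi)); congr (_ - _).
  by apply: eq_bigr => i _; rewrite linearZ.
have [c cP] := MT_spanned MTv.
exists (\row_i c (enum_val i)); split=> [phi|c' c'P].
  rewrite tev_sub cP big_enum_val -sumrB big1 // => i _.
  by rewrite mxE subrr.
apply/rowP => i; rewrite !mxE; apply/eqP; rewrite -subr_eq0; apply/eqP.
apply: (subset_tpoly_free (d := fun i => c (enum_val i) - c' 0 i)) => phi.
have := c'P phi; rewrite tev_sub cP big_enum_val -sumrB => c'0.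
by rewrite -[RHS]c'0; apply: eq_bigr => j _; rewrite scalerBl.
Qed.

Lemma card_small_subsets n : #|D n| = (\sum_(j < m.+1) 'C(n, j))%N.
Proof.
rewrite -sum1_card (partition_big (fun S : {set 'I_n} => inord #|S| : 'I_m.+1)
  xpredT) //=; apply: eq_bigr => j _.
rewrite -[n in 'C(n, _)]card_ord -card_draws -sum1_card; apply: eq_bigl => S.
rewrite !inE; apply/andP/eqP => [[le_S /eqP <-]|Sj]; first by rewrite inordK.
by rewrite Sj -ltnS ltn_ord inord_val.
Qed.

Lemma trace_codim_sum n : trace_codim U n = (\sum_(j < m.+1) 'C(n, j))%N.
Proof.
rewrite -card_small_subsets; apply: quot_dim_eq (subset_tpoly_quot_basis n).
  by move=> phi; rewrite linear0.
by move=> a u v u0 v0 phi; rewrite linearP /= u0 v0 scaler0 addr0.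
Qed.

End Codimension.

(** * Growth of partial sums of binomial coefficients *)

Section BinomialSumGrowth.
Context (R : realType).

Lemma ffact_le_exp n m : (n ^_ m <= n ^ m)%N.
Proof.
by elim: m => // m IHm; rewrite ffactnSr expnSr leq_mul // leq_subr.
Qed.

(** The statement is multiplied by n so as to say that the difference is
O(n^(m-1)) also for m = 0. *)
Lemma ffact_asymp m : exists K : nat, forall n,
  `|(n ^_ m)%:R - n%:R ^+ m| * n%:R <= K%:R * n%:R ^+ m :> R.
Proof.
elim: m => [|m [K Km]]; first by exists 0%N => n; rewrite subrr normr0 !mul0r.
exists (K + m)%N => n.
have -> : (n ^_ m.+1)%:R = (n ^_ m)%:R * (n%:R - m%:R) :> R.
  rewrite ffactnSr natrM.
  have [le_mn|lt_nm] := leqP m n; first by rewrite natrB.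
  by rewrite ffact_small // !mul0r.
have -> : (n ^_ m)%:R * (n%:R - m%:R) - n%:R ^+ m.+1 =
    ((n ^_ m)%:R - n%:R ^+ m) * n%:R - (n ^_ m)%:R * m%:R :> R.
  by rewrite exprSr mulrBl mulrBr addrAC.
rewrite natrD exprSr !mulrA.
apply: le_trans (_ : (`|(n ^_ m)%:R - n%:R ^+ m| * n%:R +
  m%:R * n%:R ^+ m) * n%:R <= _).
  rewrite ler_wpM2r // (le_trans (ler_normB _ _)) //.
  rewrite normrM normr_nat lerD2l normrM !normr_nat mulrC ler_wpM2l //.
  by rewrite -natrX ler_nat ffact_le_exp.
by rewrite ler_wpM2r // mulrDl lerD2r.
Qed.

(** Only the term j = m reaches degree m: C(n, j) n <= n^j n <= n^m for the
others, and each contributes 1 to the constant. *)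
Lemma bin_sum_asymp m : exists K : nat, forall n,
  `|(\sum_(j < m.+1) 'C(n, j))%:R - (m`!)%:R^-1 * n%:R ^+ m| * n%:R
    <= K%:R * n%:R ^+ m :> R.
Proof.
have [K Km] := ffact_asymp m; exists (m + K)%N => n.
rewrite big_ord_recr /= natrD -addrA natrD mulrDl.
have fact_ge1 : 1 <= (m`!)%:R :> R by rewrite ler1n fact_gt0.
have -> : 'C(n, m)%:R = (m`!)%:R^-1 * (n ^_ m)%:R :> R.
  by rewrite -bin_ffact natrM mulrCA mulVf ?mulr1 // pnatr_eq0 -lt0n fact_gt0.
rewrite -mulrBr; apply: le_trans (ler_wpM2r _ (ler_normD _ _)) _ => //.
rewrite mulrDl lerD //; last first.
  rewrite normrM ger0_norm ?invr_ge0 // -mulrA (le_trans _ (Km n)) //.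
  by rewrite ler_piMl ?mulr_ge0 // invf_le1 // (lt_le_trans _ fact_ge1).
rewrite normr_nat -natrX -!natrM ler_nat big_distrl /=.
apply: (@leq_trans (\sum_(j < m) n ^ m)%N); last first.
  by rewrite sum_nat_const card_ord.
apply: leq_sum => j _; case: n {Km} => [|n]; first by rewrite muln0.
apply: (@leq_trans (n.+1 ^ j.+1)%N); last by rewrite leq_pexp2l.
rewrite expnSr leq_mul2r /= (leq_trans _ (ffact_le_exp _ _)) //.
by rewrite -bin_ffact leq_pmulr // fact_gt0.
Qed.

Lemma asymp_poly_bin_sum m :
  asymp_poly (fun n => \sum_(j < m.+1) 'C(n, j))%N (m`!%:R^-1 : R) m.
Proof.
apply/eqaddoP => e e_gt0; have [K Km] := bin_sum_asymp m.
have q_gt0 : 0 < m`!%:R^-1 :> R by rewrite invr_gt0 ltr0n fact_gt0.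
near=> n.
have n_gt0 : 0 < n%:R :> R by near: n; exact: nbhs_infty_gtr.
have n_gtK : K%:R / (e * m`!%:R^-1) < n%:R :> R.
  by near: n; exact: nbhs_infty_gtr.
rewrite -(ler_pM2r n_gt0) (le_trans (Km n)) // normrM normrX normr_nat.
rewrite (gtr0_norm q_gt0) // !mulrA mulrAC ler_wpM2r ?exprn_ge0 // mulrC.
by rewrite -ler_pdivrMr ?mulr_gt0 // ltW.
Unshelve. all: by end_near. Qed.

End BinomialSumGrowth.

(** * Trace algebras generated by a nilpotent element *)

Section PolynomialTrace.
Context (F : fieldType) (alpha : F).

Definition polytr (P : {poly F}) : F := alpha * P`_0.

Lemma polytr_is_scalar : scalar polytr.
Proof. by move=> c p q; rewrite /polytr coefD coefZ mulrDr mulrCA. Qed.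

HB.instance Definition _ :=
  GRing.isLinear.Build F {poly F} F _ polytr polytr_is_scalar.

Lemma polytrC p q : polytr (p * q) = polytr (q * p).
Proof. by rewrite mulrC. Qed.

Definition poly_trace : trace_alg F :=
  @TraceAlg F {poly F} polytr polytrC.

(** Substitution of z into polynomials is a morphism of trace algebras, and such
morphisms commute with the evaluation of trace polynomials. *)
Lemma tev_horner_alg (A : trace_alg F) (z : A) (phi : nat -> {poly F}) p :
    (forall P : {poly F}, ta_tr A (horner_alg z P) = polytr P) ->
  tev (fun i => horner_alg z (phi i)) p =
  horner_alg z (tev (A := poly_trace) phi p).
Proof.
move=> trz.
have ev_word_horner w : ev_word (fun i => horner_alg z (phi i)) w =
    horner_alg z (ev_word (A := poly_trace) phi w).
  by rewrite /ev_word rmorph_prod.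
rewrite /tev linear_sum; apply: eq_bigr => mon _.
rewrite /ev_tmon [RHS]linearZ /= mulr_algl; congr (_ *: _).
rewrite [RHS]linearZ /= mulr_algl ev_word_horner; congr (_ *: _).
apply: eq_bigr => c _; congr (_ ^+ _).
by rewrite /ev_cword ev_word_horner trz.
Qed.

End PolynomialTrace.

Lemma tr_horner_alg (F : fieldType) (A : trace_alg F) (z : A) (alpha : F) :
    ta_tr A 1 = alpha -> (forall a, ta_tr A (a * z) = 0) ->
  forall P : {poly F}, ta_tr A (horner_alg z P) = polytr alpha P.
Proof.
move=> tr1 trz; elim/poly_ind => [|P c IHP].
  by rewrite !linear0.
rewrite /polytr rmorphD rmorphM /= horner_algX horner_algC linearD trz add0r.
by rewrite linearZ /= tr1 coefD coefMX coefC add0r mulrC.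
Qed.

(** A polynomial killed by y is divisible by X^k, as its lowest term would
otherwise survive multiplication by a power of y. This is why F[y] has no more
relations than F[x]. *)
Lemma horner_alg_eq0_transfer (F : fieldType) (A B : algType F)
    (x : A) (y : B) k :
    x ^+ k = 0 -> y ^+ k = 0 -> y ^+ k.-1 != 0 ->
  forall P : {poly F}, horner_alg y P = 0 -> horner_alg x P = 0.
Proof.
move=> xk yk yk1 P Py.
suff: 'X^k %| P.
  by move=> /dvdpP[Q ->]; rewrite rmorphM rmorphXn /= horner_algX xk mulr0.
elim: {-2}k (leqnn k) => [|j IHj] lt_jk; first by rewrite expr0 dvd1p.
have [Q defP] := dvdpP _ _ (IHj (ltnW lt_jk)).
suff: root Q 0.
  rewrite defP root_factor_theorem polyC0 subr0 => /dvdpP[Q' ->].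
  by rewrite -mulrA -exprS dvdp_mull.
have /factor_theorem[Q' defQ] : root (Q - (Q.[0])%:P) 0.
  by rewrite rootE !hornerE subrr.
apply: contraNT yk1 => Q0.
have := congr1 (fun u => u * y ^+ (k.-1 - j)) Py.
rewrite mul0r defP rmorphM rmorphXn /= horner_algX -mulrA -exprD.
have k_gt0 : (0 < k)%N by apply: leq_ltn_trans lt_jk.
have -> : (j + (k.-1 - j) = k.-1)%N by rewrite subnKC // -ltnS prednK.
rewrite -[Q](subrK (Q.[0])%:P) defQ polyC0 subr0 rmorphD rmorphM /=.
rewrite horner_algX horner_algC mulrDl -mulrA -exprS prednK // yk mulr0 add0r.
rewrite -scalerAl mul1r => /eqP; rewrite scaler_eq0 => /orP[|->//].
by rewrite -rootE (negPf Q0).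
Qed.

(** A is a quotient of the trace algebra F[X], so an evaluation in A lifts to
F[X]. Its image in F[y] vanishes on an identity of B, and the kernel of
F[X] -> F[y] is contained in that of F[X] -> A. *)
Lemma trace_id_transfer (F : fieldType) (A B : trace_alg F) (alpha : F)
    (x : A) (y : B) k :
    ta_tr A 1 = alpha -> (forall a, ta_tr A (a * x) = 0) ->
    ta_tr B 1 = alpha -> (forall b, ta_tr B (b * y) = 0) ->
    x ^+ k = 0 -> y ^+ k = 0 -> y ^+ k.-1 != 0 ->
    (forall a : A, exists P : {poly F}, a = horner_alg x P) ->
  (trace_id B `<=` trace_id A)%classic.
Proof.
move=> trA1 trx trB1 try_ xk yk yk1 genA p idBp phi.
have /choice[P phiE] i := genA (phi i).
have -> : phi = fun i => horner_alg x (P i) by apply/funext.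
rewrite (tev_horner_alg (alpha := alpha)) ; last exact: tr_horner_alg.
apply: (horner_alg_eq0_transfer xk yk yk1).
rewrite -(tev_horner_alg (alpha := alpha)); last exact: tr_horner_alg.
exact: idBp.
Qed.

(** * Codimensions from a commutativity hypothesis *)

(** Commutativity here is a property of B, not part of its type; the structure
of commutative algebra is rebuilt on the same carrier and operations. *)
Lemma trace_codim_binomial_sum (F : fieldType) (B : trace_alg F) (alpha : F)
    (m : nat) (z : B) n :
    [pchar F] =i pred0 -> alpha != 0 ->
    (forall x y : B, x * y = y * x) -> ta_tr B 1 = alpha ->
    (forall x y : B, alpha * ta_tr B (x * y) = ta_tr B x * ta_tr B y) ->
    ta_tr B z = 0 -> z ^+ m != 0 ->
    (forall x : B, ta_tr B x = 0 -> x ^+ m.+1 = 0) ->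
  trace_codim B n = (\sum_(j < m.+1) 'C(n, j))%N.
Proof.
move=> F0 alpha_neq0; case: B z => A tr trC /= z mulC tr1 trM trz zm nil.
pose CM := GRing.PzRing_hasCommutativeMul.Build A mulC.
pose C : comAlgType F := HB.pack (GRing.Algebra.sort A) CM.
exact: (@trace_codim_sum F C tr trC alpha F0 alpha_neq0 tr1 trM m z trz zm nil).
Qed.

(** * The algebra of Toeplitz matrices and its variety *)

Section ToeplitzAlgebra.
Context (F : fieldType) (k : nat).
Local Notation A := (Calg F k).

Definition shift_mx : 'M[F]_k.-1.+1 := \matrix_(i, j) (j == i.+1 :> nat)%:R.

Lemma shift_mx_toeplitz : shift_mx \in toeplitz_pred (F:=F) (k:=k).
Proof.
apply/toeplitzP; exists (fun t => (t == 1%N)%:R) => i j; rewrite mxE.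
case: leqP => [le_ij|lt_ji]; first by rewrite -[in RHS](eqn_add2r i) subnK.
by rewrite (ltn_eqF (leqW lt_ji)).
Qed.

Definition toeplitz_shift : A := CAlg shift_mx_toeplitz.

Lemma shiftX_entry t (i j : 'I_k.-1.+1) :
  val (toeplitz_shift ^+ t) i j = (j == i + t :> nat)%N%:R.
Proof.
elim: t i => [|t IHt] i.
  by rewrite expr0 addn0 mxE -val_eqE eq_sym.
rewrite exprS rmorphM mxE /=.
have [lt_i1|le_i1] := ltnP i.+1 k.-1.+1; last first.
  rewrite big1 => [|l _].
    rewrite ltn_eqF // (leq_trans (ltn_ord j)) // (leq_trans le_i1) //.
    by rewrite addnS ltnS leq_addr.
  by rewrite !mxE ltn_eqF ?mul0r // (leq_trans (ltn_ord l)).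
rewrite (bigD1 (Ordinal lt_i1)) //= big1 => [|l l_neq].
  by rewrite addr0 mxE eqxx mul1r IHt /= addSnnS.
by rewrite mxE (_ : _ == _ = false) ?mul0r //; apply: negbTE.
Qed.

(** The entry a_(t+1) is the coefficient of the t-th power of the shift. This
identifies C_k with F[X] / (X^k), and commutativity follows at once. *)
Lemma toeplitz_horner (u : A) :
  exists P : {poly F}, u = horner_alg toeplitz_shift P.
Proof.
have [a ua] := toeplitzP _ (valP u); exists (\poly_(t < k.-1.+1) a t).
have -> : horner_alg toeplitz_shift (\poly_(t < k.-1.+1) a t) =
    \sum_(t < k.-1.+1) a t *: toeplitz_shift ^+ t.
  rewrite poly_def linear_sum; apply: eq_bigr => t _.
  by rewrite linearZ /= mulr_algl rmorphXn /= horner_algX.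
apply/val_inj/matrixP => i j.
rewrite (raddf_sum val) /= summxE ua.
rewrite (eq_bigr (fun t : 'I_k.-1.+1 => a t * (j == i + t :> nat)%N%:R));
  last first.
  move=> t _; rewrite -shiftX_entry.
  by rewrite -[LHS]/((a t *: val (toeplitz_shift ^+ t)) i j) mxE.
case: leqP => [le_ij|lt_ji]; last first.
  rewrite big1 // => t _.
  by rewrite (ltn_eqF (leq_trans lt_ji (leq_addr _ _))) mulr0.
have lt_t : (j - i < k.-1.+1)%N by rewrite (leq_ltn_trans (leq_subr _ _)).
rewrite (bigD1 (Ordinal lt_t)) //= subnKC // eqxx mulr1 big1 ?addr0 // => t.
rewrite -val_eqE /= => t_neq; rewrite -(subnKC le_ij) eqn_add2l eq_sym.
by rewrite (negPf t_neq) mulr0.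
Qed.

Lemma shiftX_eq0 : toeplitz_shift ^+ k.-1.+1 = 0.
Proof.
apply/val_inj/matrixP => i j; rewrite shiftX_entry [RHS]mxE ltn_eqF //.
by rewrite (leq_trans (ltn_ord j)) // leq_addl.
Qed.

Lemma shiftX_neq0 : toeplitz_shift ^+ k.-1 != 0.
Proof.
apply/eqP => /(congr1 (fun u : A => val u ord0 ord_max)) /eqP.
by rewrite shiftX_entry [X in _ == X]mxE add0n eqxx oner_eq0.
Qed.

Lemma toeplitz_mulC (u v : A) : u * v = v * u.
Proof.
have [[P ->] [Q ->]] := (toeplitz_horner u, toeplitz_horner v).
by rewrite -!rmorphM mulrC.
Qed.

Lemma Ctr1 alpha : Ctr alpha (1 : A) = alpha.
Proof. by rewrite /Ctr mxE eqxx mulr1. Qed.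

Lemma CtrM alpha (u v : A) :
  alpha * Ctr alpha (u * v) = Ctr alpha u * Ctr alpha v.
Proof.
rewrite /Ctr rmorphM mxE big_ord_recl big1 ?addr0 => [|i _]; last first.
  by have [a va] := toeplitzP _ (valP v); rewrite va mulr0.
by rewrite [RHS]mulrACA mulrA.
Qed.

Lemma Ctr_mul_shift alpha (u : A) : Ctr alpha (u * toeplitz_shift) = 0.
Proof.
rewrite /Ctr rmorphM mxE big1 ?mulr0 // => i _.
by rewrite /= mxE mulr0.
Qed.

Lemma Ctr_ker_nilpotent alpha (u : A) :
  alpha != 0 -> Ctr alpha u = 0 -> u ^+ k.-1.+1 = 0.
Proof.
move=> alpha_neq0; have [P ->] := toeplitz_horner u.
have trP := @tr_horner_alg F (Ctrace k alpha) toeplitz_shift alpha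
  (Ctr1 alpha) (Ctr_mul_shift alpha) P.
rewrite [Ctr _ _]trP /polytr => /eqP; rewrite mulf_eq0 (negPf alpha_neq0) /=.
rewrite -horner_coef0 -rootE => /factor_theorem[Q ->].
rewrite polyC0 subr0 rmorphM /= horner_algX.
rewrite exprMn_comm; last exact: toeplitz_mulC.
by rewrite shiftX_eq0 mulr0.
Qed.

End ToeplitzAlgebra.

Lemma tev_binomial (F : fieldType) (A : trace_alg F) (phi : nat -> A)
    c m c' m' :
  tev phi (<< c *g m >> - << c' *g m' >>) =
  c *: ev_tmon phi m - c' *: ev_tmon phi m'.
Proof. by rewrite linearB; congr (_ - _); apply: tevU. Qed.

Section VarietyOfC.
Context (F : fieldType) (k : nat) (alpha : F) (B : trace_alg F).
Hypotheses (alpha_neq0 : alpha != 0).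
Hypothesis varB : var (Ctrace k alpha) B.

Lemma var_mulC (x y : B) : x * y = y * x.
Proof.
pose p : tpoly F := << tmon [::] [:: 0; 1]%N >> - << tmon [::] [:: 1; 0]%N >>.
have evp (A : trace_alg F) (phi : nat -> A) :
    tev phi p = phi 0%N * phi 1%N - phi 1%N * phi 0%N.
  rewrite tev_binomial !ev_tmonE /ev_word !big_nil !scale1r.
  by rewrite !big_cons !big_nil !mulr1.
have idp : trace_id (Ctrace k alpha) p.
  by move=> phi; rewrite evp toeplitz_mulC subrr.
have := varB idp (fun i => if i == 0%N then x else y).
by rewrite evp /= => /eqP; rewrite subr_eq0 => /eqP.
Qed.

Lemma var_tr1 : ta_tr B 1 = alpha.
Proof.
pose p : tpoly F := << tmon [:: [::]] [::] >> - << alpha *g tmon [::] [::] >>.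
have evp (A : trace_alg F) (phi : nat -> A) :
    tev phi p = (ta_tr A 1 - alpha)%:A.
  rewrite tev_binomial !ev_tmonE /ev_word !big_nil big_seq1 big_nil !scale1r.
  by rewrite scalerBl.
have idp : trace_id (Ctrace k alpha) p.
  by move=> phi; rewrite evp [ta_tr _ 1]Ctr1 subrr scale0r.
have := varB idp (fun=> 0); rewrite evp => /eqP.
by rewrite scaler_eq0 oner_eq0 orbF subr_eq0 => /eqP.
Qed.

Lemma var_trM (x y : B) : alpha * ta_tr B (x * y) = ta_tr B x * ta_tr B y.
Proof.
pose p : tpoly F := << alpha *g tmon [:: [:: 0; 1]%N] [::] >> -
  << tmon [:: [:: 0%N]; [:: 1%N]] [::] >>.
have evp (A : trace_alg F) (phi : nat -> A) :
    tev phi p = (alpha * ta_tr A (phi 0%N * phi 1%N) -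
                 ta_tr A (phi 0%N) * ta_tr A (phi 1%N))%:A.
  rewrite tev_binomial !ev_tmonE /ev_word scale1r !big_cons !big_nil !mulr1.
  by rewrite scalerA -scalerBl.
have idp : trace_id (Ctrace k alpha) p.
  by move=> phi; rewrite evp CtrM subrr scale0r.
have := varB idp (fun i => if i == 0%N then x else y); rewrite evp /= => /eqP.
by rewrite scaler_eq0 oner_eq0 orbF subr_eq0 => /eqP.
Qed.

(** The identity is (x - Tr(x) / alpha)^k, expanded by the binomial formula
since trace polynomials are linear combinations of monomials; on an element of
trace zero it reduces to x^k. *)
Lemma var_nil (x : B) : ta_tr B x = 0 -> x ^+ k.-1.+1 = 0.
Proof.
set N := k.-1.+1 => trx.
pose p : tpoly F := \sum_(i < N.+1)
  << (- alpha^-1) ^+ i *+ 'C(N, i) *g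
     tmon (nseq i [:: 0%N]) (nseq (N - i) 0%N) >>.
have evp (A : trace_alg F) (phi : nat -> A) :
    tev phi p = (phi 0%N - (alpha^-1 * ta_tr A (phi 0%N))%:A) ^+ N.
  have cA (c : F) : GRing.comm (phi 0%N) c%:A.
    by rewrite /GRing.comm mulr_algl mulr_algr.
  rewrite -scaleNr -mulNr exprDn_comm // linear_sum; apply: eq_bigr => i _.
  rewrite [LHS]tevU ev_tmonE /ev_word !big_nseq !iter_mulr_1.
  rewrite big_seq1 scalerA exprZn expr1n -scalerAr mulr1 exprMn.
  by rewrite scalerMnl mulrnAl.
have idp : trace_id (Ctrace k alpha) p.
  move=> phi; rewrite evp; apply: (Ctr_ker_nilpotent alpha_neq0).
  by rewrite linearB linearZ /= Ctr1 mulrAC mulVf // mul1r subrr.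
by have := varB idp (fun=> x); rewrite evp /= trx mulr0 scale0r subr0.
Qed.

End VarietyOfC.

(** * Minimality *)

(** The trace of 0 is 0 and 0 ^+ 0 = 1, so the least exponent killing the kernel
of the trace is positive. *)
Lemma nil_index (F : fieldType) (B : trace_alg F) k :
    (forall x : B, ta_tr B x = 0 -> x ^+ k.+1 = 0) ->
  exists s (z : B), [/\ (s <= k)%N, ta_tr B z = 0, z ^+ s != 0 &
    forall x : B, ta_tr B x = 0 -> x ^+ s.+1 = 0].
Proof.
move=> nil; pose nilb s := `[< forall x : B, ta_tr B x = 0 -> x ^+ s = 0 >].
have nilbk : nilb k.+1 by apply/asboolP.
case: (ex_minnP (ex_intro nilb _ nilbk)) => -[|s] /asboolP nils min_s.
  by have /eqP := nils 0 (linear0 _); rewrite expr0 oner_eq0.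
have /asboolPn/existsNP[z /not_implyP[trz /eqP zs]] : ~~ nilb s.
  by apply/negP => /min_s; rewrite ltnn.
by exists s, z; split=> //; rewrite -ltnS min_s.
Qed.

Lemma var_nil_index (F : fieldType) k (alpha : F) (B : trace_alg F) (z : B) :
    alpha != 0 -> var (Ctrace k alpha) B -> ta_tr B z = 0 -> z ^+ k.-1 != 0 ->
  (trace_id B `<=` trace_id (Ctrace k alpha))%classic.
Proof.
move=> alpha_neq0 varB trz zk.
apply: (@trace_id_transfer _ (Ctrace k alpha) B alpha
  (toeplitz_shift F k) z k.-1.+1) => //.
- exact: Ctr1.
- exact: Ctr_mul_shift.
- exact: var_tr1 varB.
- move=> b; apply: (mulfI alpha_neq0).
  by rewrite (var_trM varB) trz !mulr0.
- exact: shiftX_eq0.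
- exact: (var_nil alpha_neq0 varB).
- exact: toeplitz_horner.
Qed.

Theorem theorem25 (R : realType) (F : fieldType) (k : nat) (alpha : F) :
  [pchar F] =i pred0 -> (2 <= k)%N -> alpha != 0 ->
  minimal_poly_growth R (Ctrace k alpha).
Proof.
move=> F0 k_ge2 alpha_neq0.
have fact_gt0R m : 0 < (m`!%:R)^-1 :> R by rewrite invr_gt0 ltr0n fact_gt0.
exists k.-1, (k.-1`!%:R^-1); split=> //.
- by rewrite -ltnS prednK // ltnW.
- have -> : trace_codim (Ctrace k alpha) =
      (fun n => \sum_(j < k.-1.+1) 'C(n, j))%N.
    apply/funext => n.
    apply: (@trace_codim_binomial_sum _ (Ctrace k alpha) alpha k.-1
      (toeplitz_shift F k)) => //.
    + exact: toeplitz_mulC.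
    + exact: Ctr1.
    + exact: CtrM.
    + by rewrite -[toeplitz_shift F k]mul1r; apply: Ctr_mul_shift.
    + exact: shiftX_neq0.
    + by move=> x; apply: Ctr_ker_nilpotent.
  exact: asymp_poly_bin_sum.
move=> B tr trC U [subU [B' [varAB' not_varUB']]].
have varAU : var (Ctrace k alpha) U by apply: subU => p.
have [s [z [le_sk trz zs nils]]] := nil_index (var_nil alpha_neq0 varAU).
exists s, (s`!%:R^-1); split=> //; last first.
  have -> : trace_codim U = (fun n => \sum_(j < s.+1) 'C(n, j))%N.
    apply/funext => n; apply: (@trace_codim_binomial_sum _ U alpha s z) => //.
    - exact: var_mulC varAU.
    - exact: var_tr1 varAU.
    - exact: var_trM varAU.
  exact: asymp_poly_bin_sum.
(* With s = k - 1 every identity of U would hold in C_k, hence in B'. *)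
rewrite ltn_neqAle le_sk andbT; apply/eqP => s_eq; rewrite s_eq in zs.
apply: not_varUB' => p /(var_nil_index alpha_neq0 varAU trz zs).
exact: varAB'.
Qed.
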